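(* Let $n>k\ge 1$ be relatively prime integers and let $k'$ be the unique integer such that $n>k'\ge1$ and $kk'=1$ in $\mathbb{Z}_n$. For all $\tau\in\mathbb{C}$, there is an isomorphism of algebras $\Phi:Q_{n,k}(E,\tau)\to Q_{n,k'}(E,\tau)$ given by $\Phi(x_i)=x_{ki}$.
   Context: Notation: $e(z)=e^{2\pi i z}$; $\mathbb{Z}_n=\mathbb{Z}/n\mathbb{Z}$. Fix $\eta\in\mathbb{C}$ in the upper half-plane, $\Lambda=\mathbb{Z}+\mathbb{Z}\eta$, $E=\mathbb{C}/\Lambda$, and $E[n]=\frac1n\Lambda/\Lambda$. Let $\theta(z)=\sum_{m\in\mathbb{Z}}(-1)^m e\big(mz+\tfrac12 m(m-1)\eta\big)$ and, for $\alpha\in\mathbb{Z}$, $$\theta_\alpha(z)=e\Big(\alpha z+\tfrac{\alpha}{2n}+\tfrac{\alpha(\alpha-n)}{2n}\eta\Big)\prod_{m=0}^{n-1}\theta\Big(z+\tfrac mn+\tfrac{\alpha}{n}\eta\Big),$$ which depends only on $\alpha$ modulo $n$; the zeros of the $\theta_\alpha$'s lie in $\frac1n\Lambda$. Let $V$ be a $\mathbb{C}$-vector space with basis $\{x_i\mid i\in\mathbb{Z}_n\}$ and $TV=\mathbb{C}\langle x_0,\ldots,x_{n-1}\rangle$. For $n>k\ge1$ coprime, $\tau\in\mathbb{C}-\frac1n\Lambda$ and $i,j\in\mathbb{Z}_n$ let $$r_{ij}(\tau)=\sum_{r\in\mathbb{Z}_n}\frac{\theta_{j-i+(k-1)r}(0)}{\theta_{j-i-r}(-\tau)\,\theta_{kr}(\tau)}\;x_{j-r}\otimes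 x_{i+r}\in V\otimes V.$$ Up to a non-zero scalar, $r_{ij}(\tau)$ depends only on $\tau+\Lambda$. If $r_{ij}$ is not identically zero on $\mathbb{C}-\frac1n\Lambda$, then it is nowhere zero there, and $\tau\mapsto L_{ij}(\tau):=\mathbb{C}\cdot r_{ij}(\tau)$ is a morphism $E-E[n]\to\mathbb{P}(V\otimes V)$ (the projective space of $1$-dimensional subspaces) that extends uniquely to a morphism $L_{ij}:E\to\mathbb{P}(V\otimes V)$; for $\tau\in\mathbb{C}$, $L_{ij}(\tau)\subseteq V\otimes V$ denotes the line that is the image of $\tau+\Lambda$. For all $\tau\in\mathbb{C}$, $\mathrm{rel}_{n,k}(E,\tau)\subseteq V\otimes V$ is the linear span of these $L_{ij}(\tau)$'s (over all $(i,j)$ with $r_{ij}$ not identically zero), and $Q_{n,k}(E,\tau)=TV/(\mathrm{rel}_{n,k}(E,\tau))$. *)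

(* Defs.v *)
From HB Require Import structures.
From mathcomp Require Import all_boot all_order all_algebra.
From mathcomp Require Import all_classical all_reals all_analysis.
From mathcomp Require Import complex.
(* monalg's notations clash with those of MathComp-Analysis. *)
From mathcomp Require Import -(notations) monalg.

Set Implicit Arguments.
Unset Strict Implicit.
Unset Printing Implicit Defensive.

Import Order.TTheory GRing.Theory Num.Theory.
Import numFieldNormedType.Exports.

Local Open Scope classical_set_scope.
Local Open Scope ring_scope.
Local Open Scope quotient_scope.

(* The complex numbers, packed as a numClosedFieldType so that they carry the
   topology and normed-module structure of MathComp-Analysis. *)
Definition Cplx (R : realType) : numClosedFieldType := R[i]%C.

Section Theta.
Variable R : realType.
Local Notation C := (Cplx R).

Definition expC (z : C) : C :=
  (expR (complex.Re z) * cos (complex.Im z)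
     +i* (expR (complex.Re z) * sin (complex.Im z)))%C.

(* e(z) = exp(2 pi i z) *)
Definition e2pi (z : C) : C := expC ((0 +i* (2 * pi))%C * z).

(* Bilateral series; Negz m is -(m + 1). *)
Definition sumZ (f : int -> C) : C :=
  limn (series (fun m => f (Posz m))) + limn (series (fun m => f (Negz m))).

Variable eta : C.

Definition Lambda : set C :=
  [set z | exists a b : int, z = a%:~R + b%:~R * eta].

Definition torsion (n : nat) : set C :=
  [set z | exists2 l, Lambda l & z = l / n%:R].

Definition theta (z : C) : C :=
  sumZ (fun m => (-1) ^ m * e2pi (m%:~R * z + (m * (m - 1))%:~R / 2 * eta)).

Definition theta_ (n : nat) (alpha : int) (z : C) : C :=
  e2pi (alpha%:~R * z + alpha%:~R / (2 * n%:R)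
       + (alpha * (alpha - n%:Z))%:~R / (2 * n%:R) * eta)
  * \prod_(m < n) theta (z + m%:R / n%:R + alpha%:~R / n%:R * eta).

End Theta.

Section Relations.
Variables (R : realType) (eta : Cplx R) (n k : nat).
Local Notation C := (Cplx R).

(* theta_alpha only depends on alpha modulo n, so for a residue class we take
   its representative in [0, n[.  Here, as everywhere below, 'Z_n is
   meaningful for 1 < n only. *)
Definition thetaZ (a : 'Z_n) : C -> C := theta_ eta n (Posz a).

(* V has basis x_i, i in 'Z_n; V (x) V is the space of square matrices indexed
   by 'Z_n, with u (x) v the matrix of the products u_i v_j. *)
Definition Vsp := 'rV[C]_((Zp_trunc n).+2).
Definition VV := 'M[C]_((Zp_trunc n).+2).
Definition xV (i : 'Z_n) : Vsp := delta_mx 0 i.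
Definition tens (u v : Vsp) : VV := u^T *m v.

Definition rij (i j : 'Z_n) (tau : C) : VV :=
  \sum_(r : 'Z_n)
    (thetaZ (j - i + (k%:R - 1) * r) 0
       / (thetaZ (j - i - r) (- tau) * thetaZ (k%:R * r) tau))
    *: tens (xV (j - r)) (xV (i + r)).

(* Morphisms from E = C / Lambda to P(V (x) V), as holomorphic maps: they are
   given by Lambda-periodic maps from C to lines (subspaces <[v]> with v != 0)
   which locally have a holomorphic nowhere vanishing lift to V (x) V. *)
Definition is_morphism (L : C -> {vspace VV}) : Prop :=
  (forall z l, Lambda eta l -> L (z + l) = L z) /\
  (forall z0 : C, exists f : C -> VV, \forall z \near z0,
     [/\ f z != 0, L z = <[f z]>%VS & derivable (f : C^o -> VV) z 1]).

Definition rij_nonzero (i j : 'Z_n) : Prop :=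
  exists2 tau, ~ torsion eta n tau & rij i j tau != 0.

Definition extends_rij (i j : 'Z_n) (L : C -> {vspace VV}) : Prop :=
  is_morphism L /\ forall tau, ~ torsion eta n tau -> L tau = <[rij i j tau]>%VS.

(* The extension exists and is unique when rij i j is not identically zero; the
   default value given to xget is then irrelevant. *)
Definition Lij (i j : 'Z_n) : C -> {vspace VV} :=
  xget (fun=> 0%VS) [set L | extends_rij i j L].

Definition rel_nk (tau : C) : {vspace VV} :=
  (\sum_(ij : 'Z_n * 'Z_n | `[< rij_nonzero ij.1 ij.2 >]) Lij ij.1 ij.2 tau)%VS.

End Relations.

Section QuotientAlgebra.
Variables (K : pzRingType) (A : algType K).

Definition two_sided_ideal (I : set A) : Prop :=
  [/\ I 0, forall a b, I a -> I b -> I (a + b)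
    & forall a b c, I b -> I (a * b * c)].

Definition gen_ideal (S : set A) : set A :=
  [set a | forall I, two_sided_ideal I -> S `<=` I -> I a].

Lemma gen_ideal_ideal S : two_sided_ideal (gen_ideal S).
Proof.
split=> [I [] //|a b Sa Sb I idI sSI|a b c Sb I idI sSI].
- by have [_ addI _] := idI; apply: addI; [apply: Sa|apply: Sb].
- by have [_ _ mulI] := idI; apply: mulI; apply: Sb.
Qed.

(* Properness is needed because algType excludes the zero ring. *)
Record proper_ideal := ProperIdeal {
  ideal_set : set A;
  ideal_two_sided : two_sided_ideal ideal_set;
  ideal_proper : ~ ideal_set 1 }.

Variable idl : proper_ideal.
Local Notation I := (ideal_set idl).

Let I0 : I 0. Proof. by have [] := ideal_two_sided idl. Qed.
Let ID a b : I a -> I b -> I (a + b).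
Proof. by have [_ h _] := ideal_two_sided idl; apply: h. Qed.
Let IMl a b : I b -> I (a * b).
Proof.
by have [_ _ h] := ideal_two_sided idl => Ib; rewrite -[_ * _]mulr1; apply: h.
Qed.
Let IMr a b : I a -> I (a * b).
Proof.
by have [_ _ h] := ideal_two_sided idl => Ib; rewrite -[a]mul1r; apply: h.
Qed.
Let IN a : I a -> I (- a).
Proof. by rewrite -mulN1r; apply: IMl. Qed.
Let IZ (c : K) a : I a -> I (c *: a).
Proof. by rewrite -mulr_algl; apply: IMl. Qed.

Definition eq_mod (a b : A) : bool := `[< I (a - b) >].

Lemma eq_mod_equiv : equiv_class_of eq_mod.
Proof.
split=> [a|a b|b a c]; rewrite /eq_mod.
- by rewrite subrr; apply/asboolP.
- by apply/asboolP/asboolP => /IN; rewrite opprB.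
- move=> /asboolP ab /asboolP bc; apply/asboolP.
  by rewrite -(subrK b a) -addrA; apply: ID.
Qed.

Canonical eq_mod_equiv_rel := EquivRelPack eq_mod_equiv.

Definition quot_alg := {eq_quot eq_mod}.

HB.instance Definition _ := Choice.on quot_alg.
HB.instance Definition _ := EqQuotient.on quot_alg.

Definition proj_alg (a : A) : quot_alg := \pi_quot_alg a.

Lemma proj_eq a b : (proj_alg a = proj_alg b) <-> I (a - b).
Proof.
split=> [/eqquotP/asboolP //|ab].
by apply/eqquotP/asboolP.
Qed.

Lemma repr_proj a : I (repr (proj_alg a) - a).
Proof. by apply/proj_eq; rewrite /proj_alg reprK. Qed.

Lemma proj_repr q : proj_alg (repr q) = q.
Proof. by rewrite /proj_alg reprK. Qed.

Definition qopp (p : quot_alg) := proj_alg (- repr p).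
Definition qadd (p q : quot_alg) := proj_alg (repr p + repr q).
Definition qmul (p q : quot_alg) := proj_alg (repr p * repr q).
Definition qscale (c : K) (p : quot_alg) := proj_alg (c *: repr p).

Let qoppE a : qopp (proj_alg a) = proj_alg (- a).
Proof. by apply/proj_eq; rewrite -opprD; apply/IN/repr_proj. Qed.

Let qaddE a b : qadd (proj_alg a) (proj_alg b) = proj_alg (a + b).
Proof. by apply/proj_eq; rewrite opprD addrACA; apply: ID; apply: repr_proj. Qed.

Let qmulE a b : qmul (proj_alg a) (proj_alg b) = proj_alg (a * b).
Proof.
apply/proj_eq; set a' := repr _; set b' := repr _.
have -> : a' * b' - a * b = (a' - a) * b' + a * (b' - b).
  by rewrite mulrBl mulrBr addrA subrK.
by apply: ID; [apply: IMr|apply: IMl]; apply: repr_proj.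
Qed.

Let qscaleE c a : qscale c (proj_alg a) = proj_alg (c *: a).
Proof. by apply/proj_eq; rewrite -scalerBr; apply/IZ/repr_proj. Qed.

Let qP (P : quot_alg -> Prop) : (forall a, P (proj_alg a)) -> forall q, P q.
Proof. by move=> h q; rewrite -(proj_repr q). Qed.

Let qaddA : associative qadd.
Proof. by do 3 elim/qP=> ?; rewrite !qaddE addrA. Qed.
Let qaddC : commutative qadd.
Proof. by do 2 elim/qP=> ?; rewrite !qaddE addrC. Qed.
Let qadd0 : left_id (proj_alg 0) qadd.
Proof. by elim/qP=> ?; rewrite qaddE add0r. Qed.
Let qaddN : left_inverse (proj_alg 0) qopp qadd.
Proof. by elim/qP=> ?; rewrite qoppE qaddE addNr. Qed.

HB.instance Definition _ :=
  GRing.isZmodule.Build quot_alg qaddA qaddC qadd0 qaddN.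

Let qmulA : associative qmul.
Proof. by do 3 elim/qP=> ?; rewrite !qmulE mulrA. Qed.
Let qmul1 : left_id (proj_alg 1) qmul.
Proof. by elim/qP=> ?; rewrite qmulE mul1r. Qed.
Let qmulr1 : right_id (proj_alg 1) qmul.
Proof. by elim/qP=> ?; rewrite qmulE mulr1. Qed.
Let qmulDl : left_distributive qmul qadd.
Proof. by do 3 elim/qP=> ?; rewrite !(qmulE, qaddE) mulrDl. Qed.
Let qmulDr : right_distributive qmul qadd.
Proof. by do 3 elim/qP=> ?; rewrite !(qmulE, qaddE) mulrDr. Qed.
Let qone_neq0 : proj_alg 1 != proj_alg 0.
Proof. by apply/eqP => /proj_eq; rewrite subr0; apply: ideal_proper. Qed.

HB.instance Definition _ :=
  GRing.Zmodule_isNzRing.Build quot_alg qmulA qmul1 qmulr1 qmulDl qmulDr qone_neq0.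

Let qscaleA a b v : qscale a (qscale b v) = qscale (a * b) v.
Proof. by elim/qP: v => ?; rewrite !qscaleE scalerA. Qed.
Let qscale1 : left_id 1 qscale.
Proof. by elim/qP=> ?; rewrite qscaleE scale1r. Qed.
Let qscaleDr : right_distributive qscale qadd.
Proof. by move=> c; do 2 elim/qP=> ?; rewrite !(qscaleE, qaddE) scalerDr. Qed.
Let qscaleDl v : {morph qscale^~ v : a b / a + b >-> qadd a b}.
Proof. by elim/qP: v => ? a b; rewrite !(qscaleE, qaddE) scalerDl. Qed.

HB.instance Definition _ :=
  GRing.Zmodule_isLmodule.Build K quot_alg qscaleA qscale1 qscaleDr qscaleDl.

Let qscaleAl (c : K) (u v : quot_alg) : c *: (u * v) = (c *: u) * v.
Proof.
by elim/qP: u => ?; elim/qP: v => ?; rewrite /GRing.scale /GRing.mul /= !(qscaleE, qmulE) scalerAl.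
Qed.
HB.instance Definition _ := GRing.Lmodule_isLalgebra.Build K quot_alg qscaleAl.

Let qscaleAr (c : K) (u v : quot_alg) : c *: (u * v) = u * (c *: v).
Proof.
by elim/qP: u => ?; elim/qP: v => ?; rewrite /GRing.scale /GRing.mul /= !(qscaleE, qmulE) scalerAr.
Qed.
HB.instance Definition _ := GRing.Lalgebra_isAlgebra.Build K quot_alg qscaleAr.

Lemma proj_alg_is_linear : linear proj_alg.
Proof. by move=> c a b; rewrite -qaddE -qscaleE. Qed.
Lemma proj_alg_is_monoid_morphism : monoid_morphism proj_alg.
Proof. by split=> // a b; rewrite -qmulE. Qed.
HB.instance Definition _ :=
  GRing.isLinear.Build K A quot_alg *:%R proj_alg proj_alg_is_linear.
HB.instance Definition _ :=
  GRing.isMonoidMorphism.Build A quot_alg proj_alg proj_alg_is_monoid_morphism.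

End QuotientAlgebra.

Section TensorAlgebra.
Variables (K : comNzRingType) (I : choiceType).

(* The free associative algebra K<x_i | i in I>: linear combinations of
   words. *)
Definition TV := malg (fmonom I) K.

HB.instance Definition _ := GRing.Lalgebra.on TV.

Let TV_scaleAr (c : K) (u v : TV) : c *: (u * v) = u * (c *: v).
Proof.
have comm : mkmalgU mone c * u = u * (mkmalgU mone c : TV).
  rewrite ![_ * _]malgM_def fgmulUg fgmulgU; apply: eq_bigr => w _.
  by rewrite mulrC mul1m mulm1.
by rewrite -!mul_malgC !mulrA comm.
Qed.
HB.instance Definition _ :=
  GRing.Lalgebra_isAlgebra.Build K TV TV_scaleAr.

Definition xT (i : I) : TV := mkmalgU (fmu i) 1.

End TensorAlgebra.

Section Q.
Variables (R : realType) (eta : Cplx R) (n k : nat) (tau : Cplx R).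

(* V (x) V as the degree-two part of TV *)
Definition deg2 (w : VV R n) : TV (Cplx R) 'Z_n :=
  \sum_(i : 'Z_n) \sum_(j : 'Z_n) w i j *: (xT _ i * xT _ j).

Definition rel_ideal : set (TV (Cplx R) 'Z_n) :=
  gen_ideal (deg2 @` [set` rel_nk eta n k tau]).

Lemma rel_ideal_proper : ~ rel_ideal 1.
Proof.
pose aug (a : TV (Cplx R) 'Z_n) : Cplx R := mcoeff mone a.
have augM a b : aug (a * b) = aug a * aug b by exact: rmorphM.
have augZ c a : aug (c *: a) = c * aug a by exact: mcoeffZ.
have augx i : aug (xT _ i) = 0.
  rewrite /aug /xT mcoeffU; case: eqP => // /(congr1 (@fmonom_val _)).
  by rewrite fmuE fm1.
move=> /(_ [set a | aug a = 0]) aug1.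
suff : aug 1 = 0 by move/eqP; rewrite /aug mcoeff1 eqxx oner_eq0.
apply: aug1.
  split=> [|a b /= a0 b0|a b c /= b0]; first exact: mcoeff0.
    by rewrite /aug mcoeffD [mcoeff _ a]a0 [mcoeff _ b]b0 addr0.
  by rewrite !augM b0 mulr0 mul0r.
move=> _ [w _ <-] /=; rewrite /aug /deg2 raddf_sum big1 // => i _.
rewrite raddf_sum big1 // => j _.
by rewrite [LHS]augZ augM augx mul0r mulr0.
Qed.

Definition Q_ideal : proper_ideal (TV (Cplx R) 'Z_n) :=
  ProperIdeal (gen_ideal_ideal _) rel_ideal_proper.

Definition Q : algType (Cplx R) := quot_alg Q_ideal.

Definition xQ (i : 'Z_n) : Q := proj_alg Q_ideal (xT _ i).

End Q.

(* Main.v *)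
Require Import Defs.
From HB Require Import structures.
From mathcomp Require Import all_boot all_order all_algebra.
From mathcomp Require Import all_classical all_reals all_analysis.
From mathcomp Require Import complex ring lra zify.
From mathcomp Require Import -(notations) monalg.

Set Implicit Arguments.
Unset Strict Implicit.
Unset Printing Implicit Defensive.
Import Order.TTheory GRing.Theory Num.Theory.
Import numFieldNormedType.Exports.
Local Open Scope classical_set_scope.
Local Open Scope ring_scope.

(** Write theta_a for the theta function of a residue a modulo n. The proof
rests on the reflection formula
    theta_a (- z) = - e (a / n - n z) theta_(- a) (z).
Apply the substitution x_i |-> x_(k i) to the relation r_ij (tau) of
Q_(n, k), and use the formula on each of the three theta factors of every
coefficient. The term of index r becomes, up to the sign -1, the term of index
k (r - (j - i)) of the relation r_(k j, k i) (tau) of Q_(n, k'): the three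
exponential factors cancel because the index of the numerator is the sum of
the two indices of the denominator. Hence the substitution sends r_ij (tau) to
- r_(k j, k i) (tau) (lemma [twist_rij]).

The lines L_ij are defined by extending tau |-> C r_ij (tau) across the
n-torsion points. The substitution carries an extension of one line to an
extension of the other, so it only remains to know that an extension is unique
([morphism_unique]): the complement of the torsion is dense, and two nonzero
continuous vectors which are proportional on a dense set are proportional
everywhere, since their 2 x 2 minors vanish. So the relations of Q_(n, k) are
mapped into those of Q_(n, k') at every tau ([twist_rel]).

The universal properties of the free algebra and of the quotient turn this
into a morphism Q_(n, k) -> Q_(n, k'). The hypothesis on k and k' is
symmetric, whence a morphism in the other direction; both composites fix the
generators x_i, so they are identities.

The reflection formula itself comes from
    theta (- z) = - e (- z) theta (z),  theta (z + eta) = - e (- z) theta (z),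
which are changes of index m |-> - 1 - m and m |-> m + 1 in the bilateral
series of theta. The shift by one moves a term from one half of the series to
the other and so uses their convergence, obtained by comparing a Gaussian with
a geometric series. *)

(** * The exponential function e *)

Section Exponential.
Variable R : realType.
Local Notation C := (Cplx R).
Implicit Types z w : C.

Lemma e2piD z w : e2pi (z + w) = e2pi z * e2pi w.
Proof.
rewrite /e2pi mulrDr /expC.
case: (_ * z) => a b; case: (_ * w) => c d /=.
rewrite expRD cosD sinD; apply/eqP; rewrite eq_complex /=.
by apply/andP; split; apply/eqP; ring.
Qed.

Lemma e2pi0 : e2pi (0 : C) = 1.
Proof. by rewrite /e2pi mulr0 /expC /= expR0 cos0 sin0 mulr1 mulr0. Qed.

Lemma e2pi_half : e2pi (2^-1 : C) = -1.
Proof.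
have -> : (2^-1 : C) = ((2^-1 : R)%:C)%C.
  by rewrite (rmorphV (@real_complex R)) ?rmorph_nat// unitfE pnatr_eq0.
rewrite /e2pi /expC /= !mul0r mulr0 subr0 expR0 add0r mulrAC divff ?pnatr_eq0//.
by rewrite !mul1r cospi sinpi; apply/eqP; rewrite eq_complex /= oppr0 !eqxx.
Qed.

Lemma oppr_e2pi z : - e2pi z = e2pi (z + 2^-1).
Proof. by rewrite e2piD e2pi_half mulrN1. Qed.

Lemma e2pi1 : e2pi (1 : C) = 1.
Proof. by rewrite (_ : 1 = 2^-1 + 2^-1) ?e2piD ?e2pi_half ?mulrNN ?mulr1//; field. Qed.

Lemma e2piN z : e2pi (- z) * e2pi z = 1.
Proof. by rewrite -e2piD addNr e2pi0. Qed.

Lemma e2pi_nat m : e2pi (m%:R : C) = 1.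
Proof. by elim: m => [|m IH]; rewrite ?e2pi0// -natr1 e2piD IH e2pi1 mulr1. Qed.

Lemma e2pi_int (m : int) : e2pi (m%:~R : C) = 1.
Proof.
case: m => m; first exact: e2pi_nat.
rewrite NegzE mulrNz; have := e2piN (m.+1%:R); rewrite e2pi_nat mulr1.
exact.
Qed.

Lemma e2piDint z (m : int) : e2pi (z + m%:~R) = e2pi z.
Proof. by rewrite e2piD e2pi_int mulr1. Qed.

Lemma e2pi_neq0 z : e2pi z != 0.
Proof. by apply/eqP => e; have := e2piN z; rewrite e mulr0 => /eqP; rewrite eq_sym oner_eq0. Qed.

Lemma Re_e2pi_le z : `|complex.Re (e2pi z)| <= expR (- (2 * pi * complex.Im z)).
Proof.
rewrite /e2pi /expC; case: z => a b /=; rewrite mul0r sub0r normrM ger0_norm ?expR_ge0//.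
by rewrite ler_piMr ?expR_ge0// ler_norml cos_geN1 cos_le1.
Qed.

Lemma Im_e2pi_le z : `|complex.Im (e2pi z)| <= expR (- (2 * pi * complex.Im z)).
Proof.
rewrite /e2pi /expC; case: z => a b /=; rewrite mul0r sub0r normrM ger0_norm ?expR_ge0//.
by rewrite ler_piMr ?expR_ge0// ler_norml sin_geN1 sin_le1.
Qed.

End Exponential.

(** Absorbing the sign into the exponential makes each term of theta a single
value of e, so that identities between terms are identities of exponents. *)
Lemma sign_e2pi (R : realType) (m : int) : (-1) ^ m = e2pi (m%:~R / 2) :> Cplx R.
Proof.
have nat (p : nat) : (-1) ^+ p = e2pi (p%:R / 2) :> Cplx R.
  elim: p => [|p IH]; first by rewrite mul0r e2pi0.
  by rewrite exprSr IH -[in RHS]natr1 [in RHS]mulrDl e2piD mul1r e2pi_half.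
case: m => p; first exact: nat.
rewrite NegzE -exprnN nat mulrNz mulNr.
by apply/(mulIf (e2pi_neq0 (p.+1%:R / 2))); rewrite mulVf ?e2pi_neq0// e2piN.
Qed.

(** * Convergence of Gaussian series *)

Section Series.
Variable R : realType.
Local Notation C := (Cplx R).

Lemma continuous_real_complex : continuous (fun x : R => (x%:C)%C : C).
Proof.
move=> x; apply/cvgrPdist_lt => e e0.
have ee : e = ((complex.Re e)%:C)%C by rewrite RRe_real// gtr0_real.
have e0' : 0 < complex.Re e by move: e0; rewrite ee ltcR.
near=> y; rewrite -rmorphB normc_def /= expr0n addr0 sqrtr_sqr ee ltcR.
by near: y; exact: (@cvgrPdist_lt _ R^o _ (nbhs x) _ id x).1.
Unshelve. all: by end_near. Qed.

(** Convergence is tested on real and imaginary parts, where completeness of the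
real numbers is at hand. *)
Lemma is_cvg_series_complex (f : nat -> C) :
  cvgn (series (fun m => complex.Re (f m))) -> cvgn (series (fun m => complex.Im (f m))) ->
  cvgn (series f).
Proof.
move=> cRe cIm.
have toC (u : nat -> R) : cvgn (series u) ->
    (fun p => ((series u p)%:C)%C : C) @ \oo --> ((limn (series u))%:C%C : C).
  by move=> cu; apply: continuous_cvg => //; exact: continuous_real_complex.
apply/cvg_ex; eexists.
have -> : series f = (fun p => (((series (fun m => complex.Re (f m)) p)%:C)%C : C)
    + ('i%C : C) * ((series (fun m => complex.Im (f m)) p)%:C)%C).
  apply/funext => p; rewrite /series /= !rmorph_sum mulr_sumr -big_split /=.
  by apply: eq_bigr => m _; rewrite [LHS]complexE.
by apply: cvgD; [exact: toC|apply: cvgM; [exact: cvg_cst|exact: toC]].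
Qed.

(** Completing the square: A m^2 + B m + D >= m - c for the constant c below,
so the terms are dominated by a geometric series of ratio exp (- 1). *)
Lemma is_cvg_gaussian (A B D : R) : 0 < A ->
  cvgn (series (fun m => expR (- (A * m%:R ^+ 2 + B * m%:R + D)))).
Proof.
move=> A0; pose c := (B - 1) ^+ 2 / (4 * A) - D.
apply: (@series_le_cvg _ _ (geometric (expR c) (expR (-1)))) => [m|m|m|].
- exact: expR_ge0.
- by rewrite /= mulr_ge0 ?exprn_ge0 ?expR_ge0.
- rewrite /= -expRM_natr -expRD ler_expR -subr_ge0.
  have -> : c + -1 * m%:R - - (A * m%:R ^+ 2 + B * m%:R + D) =
      A * (m%:R + (B - 1) / (2 * A)) ^+ 2.
    by rewrite /c; field; rewrite gt_eqF.
  by rewrite mulr_ge0 ?sqr_ge0 ?ltW.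
- by apply: is_cvg_geometric_series; rewrite ger0_norm ?expR_ge0// expR_lt1 oppr_lt0.
Qed.

Lemma is_cvg_series_e2pi (w : nat -> C) (A B D : R) : 0 < A ->
  (forall m, complex.Im (w m) = A * m%:R ^+ 2 + B * m%:R + D) ->
  cvgn (series (fun m => e2pi (w m))).
Proof.
move=> A0 wE.
have pi2 : 0 < 2 * pi :> R by rewrite mulr_gt0 ?pi_gt0.
have cG := @is_cvg_gaussian (2 * pi * A) (2 * pi * B) (2 * pi * D) (mulr_gt0 pi2 A0).
have bound (u : nat -> R) :
    (forall m, `|u m| <= expR (- (2 * pi * complex.Im (w m)))) -> cvgn (series u).
  move=> ub; apply: (@normed_cvg _ R^o).
  apply: series_le_cvg cG => m /=; rewrite ?expR_ge0//.
  by apply: (le_trans (ub m)); rewrite wE !mulrDr !mulrA.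
apply: is_cvg_series_complex; apply: bound => m /=.
- exact: Re_e2pi_le.
- exact: Im_e2pi_le.
Qed.

End Series.

(** * Changes of index in bilateral series *)

Section BilateralSums.
Variable R : realType.
Local Notation C := (Cplx R).
Implicit Type f : int -> C.

(** Reflecting about - 1 / 2, rather than about 0, merely exchanges the halves
m >= 0 and m < 0 of the bilateral sum. *)
Lemma sumZ_opp f : sumZ (fun m => f (- 1 - m)) = sumZ f.
Proof.
rewrite /sumZ addrC; congr (limn (series _) + limn (series _)); apply/funext => m.
- by congr f; lia.
- by congr f; lia.
Qed.

Lemma lim_series_shift (u : nat -> C) : cvgn (series u) ->
  limn (series (fun m => u m.+1)) = limn (series u) - u 0%N.
Proof.
move=> cu; apply: (@cvg_lim C); first exact: norm_hausdorff.
have -> : series (fun m => u m.+1) = (fun m => series u m.+1 - u 0%N).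
  by apply/funext => m; rewrite /series /= big_nat_recl// addrC addKr.
by apply: cvgB; [rewrite cvg_shiftS|exact: cvg_cst].
Qed.

(** The term f 0 passes from the half of nonnegative indices to the other one;
splitting it off a limit is what requires convergence. *)
Lemma sumZ_shift f :
  cvgn (series (fun m => f (Posz m))) -> cvgn (series (fun m => f (Negz m))) ->
  sumZ (fun m => f (m + 1)) = sumZ f.
Proof.
move=> cp cn; rewrite /sumZ.
have -> : (fun m : nat => f (Posz m + 1)) = (fun m => f (Posz m.+1)).
  by apply/funext => m; congr f; lia.
rewrite (lim_series_shift cp).
have cn' : cvgn (series (fun m => f (Negz m + 1))).
  have /cvg_ex[l cl] : cvgn ((fun _ : nat => f 0) + series (fun m => f (Negz m))).
    exact: (@is_cvgD C _ _ _ _ _ _ (is_cvg_cst _) cn).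
  apply/cvg_ex; exists l; rewrite -cvg_shiftS.
  apply: cvg_trans cl; apply: near_eq_cvg; near=> m => /=.
  rewrite /series /= big_nat_recl//; congr (f _ + _).
  by apply: eq_bigr => p _; congr f; lia.
have := lim_series_shift cn'.
have -> : (fun m => f (Negz m.+1 + 1)) = (fun m => f (Negz m)).
  by apply/funext => m; congr f; lia.
move=> ->; rewrite (_ : Negz 0 + 1 = 0) //; ring.
Unshelve. all: by end_near. Qed.

Lemma sumZZ f (c : C) :
  cvgn (series (fun m => f (Posz m))) -> cvgn (series (fun m => f (Negz m))) ->
  sumZ (fun m => c * f m) = c * sumZ f.
Proof.
have limZ (u : nat -> C) : cvgn (series u) ->
    limn (series (fun m => c * u m)) = c * limn (series u).
  move=> cu; apply: (@cvg_lim C); first exact: norm_hausdorff.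
  have -> : series (fun m => c * u m) = (fun p => c * series u p).
    by apply/funext => p; rewrite /series /= mulr_sumr.
  by apply: cvgM; [exact: cvg_cst|exact: cu].
by move=> cp cn; rewrite /sumZ mulrDr !limZ.
Qed.

End BilateralSums.

(** * Functional equations of theta functions *)

Section Theta.
Variables (R : realType) (eta : Cplx R).
Hypothesis eta_gt0 : 0 < complex.Im eta.
Local Notation C := (Cplx R).

Definition theta_term (z : C) (m : int) : C :=
  e2pi (m%:~R / 2 + m%:~R * z + (m * (m - 1))%:~R / 2 * eta).

Lemma thetaE z : theta eta z = sumZ (theta_term z).
Proof.
rewrite /theta; congr sumZ; apply/funext => m.
by rewrite sign_e2pi -e2piD addrA.
Qed.

Lemma Im_realM (x : R) z : complex.Im ((x%:C)%C * z : C) = x * complex.Im z.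
Proof. by case: z => a b /=; rewrite mul0r addr0. Qed.

(** The imaginary part of the exponent is quadratic in m with leading
coefficient Im eta / 2 > 0: the series of theta is Gaussian. *)
Lemma Im_theta_exponent z (m : int) :
  complex.Im (m%:~R / 2 + m%:~R * z + (m * (m - 1))%:~R / 2 * eta : C) =
  complex.Im eta / 2 * m%:~R ^+ 2 + (complex.Im z - complex.Im eta / 2) * m%:~R.
Proof.
have realE (p : int) : p%:~R = ((p%:~R)%:C)%C :> C.
  by rewrite (rmorph_int (@real_complex R)).
have halfE (p : int) : p%:~R / 2 = ((p%:~R / 2)%:C)%C :> C.
  by rewrite (fmorph_div (@real_complex R)) rmorph_int rmorph_nat.
rewrite halfE (realE m) halfE !raddfD /= !Im_realM -[X in X + _ + _]/0 add0r.
by rewrite intrM intrB; ring.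
Qed.

Lemma theta_term_cvg z :
  cvgn (series (fun m => theta_term z (Posz m))) /\
  cvgn (series (fun m => theta_term z (Negz m))).
Proof.
have A0 : 0 < complex.Im eta / 2 by rewrite divr_gt0.
split.
- apply: (@is_cvg_series_e2pi _ _ _ (complex.Im z - complex.Im eta / 2) 0 A0).
  by move=> m; rewrite Im_theta_exponent addr0.
(* Coefficients of the quadratic exponent at - (m + 1). *)
- apply: (@is_cvg_series_e2pi _ _ _ (3 * complex.Im eta / 2 - complex.Im z)
    (complex.Im eta - complex.Im z) A0) => m.
  by rewrite Im_theta_exponent NegzE -natr1 mulrNz; field.
Qed.

Lemma theta_shift z : theta eta (z + eta) = - (e2pi (- z) * theta eta z).
Proof.
have [cp cn] := theta_term_cvg z; have [cp' cn'] := theta_term_cvg (z + eta).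
have -> : theta eta z = e2pi (z + 2^-1) * theta eta (z + eta).
  rewrite !thetaE -(sumZ_shift cp cn) -(sumZZ _ cp' cn').
  congr sumZ; apply/funext => m; rewrite -e2piD; congr e2pi.
  by rewrite /= !intrM !intrB intrD; field.
rewrite mulrA -e2piD addKr e2pi_half; ring.
Qed.

(** Reversing the index by m |-> - 1 - m compares theta at z with theta at
- z + 2 eta; quasi-periodicity, used twice, brings it back to - z. *)
Lemma theta_opp z : theta eta (- z) = - (e2pi (- z) * theta eta z).
Proof.
have [cp cn] := theta_term_cvg (- z + eta + eta).
have -> : theta eta z = e2pi (- z + eta + 2^-1) * theta eta (- z + eta + eta).
  rewrite !thetaE -sumZ_opp -(sumZZ _ cp cn); congr sumZ; apply/funext => m.
  rewrite -e2piD -[RHS](e2piDint _ (- 1 - m)); congr e2pi.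
  by rewrite !intrM !intrB !mulrNz; field.
rewrite !theta_shift !mulrN opprK !mulrA -!e2piD.
rewrite (_ : - z + _ + _ + _ = 2^-1); last by ring.
by rewrite e2pi_half; ring.
Qed.

Lemma thetaD1 z : theta eta (z + 1) = theta eta z.
Proof.
rewrite !thetaE; congr sumZ; apply/funext => m.
rewrite -[RHS](e2piDint _ m); congr e2pi; ring.
Qed.

(** Up to the period 1, negation permutes the shifts m / n cyclically. *)
Lemma prod_thetaN n w : (0 < n)%N ->
  \prod_(m < n) theta eta (w - m%:R / n%:R) =
  \prod_(m < n) theta eta (w + m%:R / n%:R).
Proof.
case: n => // n _; have n0 : n.+1%:R != 0 :> C by rewrite pnatr_eq0.
rewrite (reindex_inj rev_ord_inj) big_ord_recr [RHS]big_ord_recl /= mulrC.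
congr (_ * _); first by rewrite subSS subnn mul0r oppr0.
apply: eq_bigr => m _; rewrite /= /bump /= -[LHS]thetaD1; congr theta.
by rewrite subSS natrB 1?ltnW// -natr1 add1n -[m.+1%:R]natr1; field; rewrite natr1.
Qed.

Lemma prod_e2pi n (c d : C) :
  \prod_(m < n) e2pi (c + m%:R * d) = e2pi (n%:R * c + n%:R * (n%:R - 1) / 2 * d).
Proof.
elim: n => [|n IH]; first by rewrite big_ord0 !mul0r addr0 e2pi0.
by rewrite big_ord_recr /= IH -e2piD -[n.+1%:R]natr1; congr e2pi; field.
Qed.

(** Both sides of the reflection formula reduce to the same product of values of
theta, at the points z + m / n - a eta / n. Here the reflection of theta turns
each factor of theta_a (- z) into such a value, up to the sign of m / n. *)
Lemma theta_alpha_oppz n (a : int) z : (0 < n)%N ->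
  theta_ eta n a (- z) =
  e2pi (- a%:~R * z + a%:~R / (2 * n%:R) + (a * (a - n%:Z))%:~R / (2 * n%:R) * eta
        + n%:R / 2 - n%:R * z + (n%:R - 1) / 2 + a%:~R * eta)
  * \prod_(m < n) theta eta (z + m%:R / n%:R - a%:~R / n%:R * eta).
Proof.
move=> n0; have nC : n%:R != 0 :> C by rewrite pnatr_eq0 -lt0n.
have -> : \prod_(m < n) theta eta (z + m%:R / n%:R - a%:~R / n%:R * eta) =
    \prod_(m < n) theta eta (z - a%:~R / n%:R * eta - m%:R / n%:R).
  by rewrite [RHS](prod_thetaN (z - a%:~R / n%:R * eta) n0);
     apply: eq_bigr => m _; congr (theta eta _); field.
have thE (m : 'I_n) : theta eta (- z + m%:R / n%:R + a%:~R / n%:R * eta) =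
    e2pi (2^-1 - z + a%:~R / n%:R * eta + m%:R * n%:R^-1)
    * theta eta (z - a%:~R / n%:R * eta - m%:R / n%:R).
  rewrite (_ : - z + _ + _ = - (z - a%:~R / n%:R * eta - m%:R / n%:R)); last by field.
  by rewrite theta_opp -[LHS]mulNr oppr_e2pi; congr (e2pi _ * _); field.
rewrite /theta_ (eq_bigr _ (fun m _ => thE m)).
rewrite big_split prod_e2pi /= mulrA -e2piD; congr (e2pi _ * _).
by field.
Qed.

(** The class of - a is represented by n - a, which moves the arguments of theta
by eta away from z + m / n - a eta / n. *)
Lemma theta_alpha_subn n (a : int) z : (0 < n)%N ->
  theta_ eta n (n%:Z - a) z =
  e2pi ((n%:R - a%:~R) * z + (n%:R - a%:~R) / (2 * n%:R)
        + (a * (a - n%:Z))%:~R / (2 * n%:R) * eta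
        + n%:R / 2 - n%:R * z - (n%:R - 1) / 2 + a%:~R * eta)
  * \prod_(m < n) theta eta (z + m%:R / n%:R - a%:~R / n%:R * eta).
Proof.
move=> n0; have nC : n%:R != 0 :> C by rewrite pnatr_eq0 -lt0n.
have thE (m : 'I_n) : theta eta (z + m%:R / n%:R + (n%:Z - a)%:~R / n%:R * eta) =
    e2pi (2^-1 - z + a%:~R / n%:R * eta + m%:R * - n%:R^-1)
    * theta eta (z + m%:R / n%:R - a%:~R / n%:R * eta).
  rewrite (_ : z + _ + _ = z + m%:R / n%:R - a%:~R / n%:R * eta + eta); last first.
    by rewrite intrB; field.
  by rewrite theta_shift -[LHS]mulNr oppr_e2pi; congr (e2pi _ * _); field.
rewrite /theta_ (eq_bigr _ (fun m _ => thE m)).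
rewrite big_split prod_e2pi /= mulrA -e2piD; congr (e2pi _ * _).
by rewrite !intrM !intrB; field.
Qed.

(** Reflection formula. The case distinction is the representative of - a in
[0, n[ when 0 <= a < n. *)
Lemma theta_alpha_reflection n (a : nat) z : (0 < n)%N ->
  theta_ eta n a (- z) =
  - (e2pi (a%:R / n%:R - n%:R * z) *
     theta_ eta n (if a == 0%N then 0%:Z else n%:Z - a%:Z) z).
Proof.
move=> n0; have nC : n%:R != 0 :> C by rewrite pnatr_eq0 -lt0n.
rewrite theta_alpha_oppz// -[RHS]mulNr oppr_e2pi.
have [->|_] := eqVneq a 0%N.
  rewrite /theta_ mulrA -e2piD; congr (_ * _); last first.
    by apply: eq_bigr => m _; congr (theta eta _); field.
  (* The two exponents differ by the integer n - 1. *)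
  rewrite -[RHS](e2piDint _ (n%:Z - 1)); congr e2pi.
  by rewrite !intrM !intrB; field.
rewrite theta_alpha_subn// mulrA -e2piD; congr (_ * _).
(* The two exponents differ by the integer n - 2. *)
rewrite -[RHS](e2piDint _ (n%:Z - 2)); congr e2pi.
by rewrite !intrM !intrB; field.
Qed.
End Theta.

(** * Morphisms from free algebras and quotient algebras *)

Section FreeAlgebra.
Variables (K : comNzRingType) (I : choiceType) (A : algType K).

Section Lift.
Variable x : I -> A.

Definition word_prod (w : fmonom I) : A := \prod_(i <- fmonom_val w) x i.

Lemma word_prod_mmorphism : mmorphism word_prod.
Proof. by split=> [u v|]; rewrite /word_prod ?fmM ?big_cat// fm1 big_nil. Qed.

HB.instance Definition _ :=
  monalg.isMultiplicative.Build (fmonom I) A word_prod word_prod_mmorphism.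

Definition TV_lift : TV K I -> A := mmap (in_alg A) word_prod.

Lemma TV_lift_is_linear : linear TV_lift.
Proof.
move=> c a b; rewrite /TV_lift raddfD; congr (_ + _).
by rewrite [LHS](@mmapZ (fmonom I) K A (in_alg A) word_prod) /= mulr_algl.
Qed.

Lemma TV_lift_is_monoid_morphism : monoid_morphism TV_lift.
Proof.
have [M1 M2] : multiplicative (mmap (in_alg A) word_prod).
  apply: commr_mmap_is_multiplicative => g m m'.
  by rewrite /GRing.comm mulr_algl mulr_algr.
by split.
Qed.

HB.instance Definition _ :=
  GRing.isLinear.Build K (TV K I) A *:%R TV_lift TV_lift_is_linear.
HB.instance Definition _ :=
  GRing.isMonoidMorphism.Build (TV K I) A TV_lift TV_lift_is_monoid_morphism.

Lemma TV_liftE i : TV_lift (xT K i) = x i.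
Proof.
by rewrite /TV_lift /xT mmapU /word_prod fmuE big_seq1 /= scale1r mul1r.
Qed.
End Lift.

Lemma TV_ext (f g : {lrmorphism TV K I -> A}) :
  (forall i, f (xT K i) = g (xT K i)) -> f =1 g.
Proof.
move=> fg.
have fgw (w : fmonom I) : f (mkmalgU w 1) = g (mkmalgU w 1).
  case: w => s; elim: s => [|i s IH].
    by rewrite (_ : mkmalgU _ 1 = 1) ?rmorph1// -fmoneE.
  have -> : mkmalgU (FMonom (i :: s)) 1 = xT K i * mkmalgU (FMonom s) 1 :> TV K I.
    by rewrite [RHS]malgM_def /xT fgmulUU mulr1; congr mkmalgU; rewrite fmuE [RHS]fmmulE.
  by rewrite (rmorphM f) (rmorphM g); congr (_ * _); [exact: fg|exact: IH].
move=> a; rewrite (monalgE a) !raddf_sum; apply: eq_bigr => w _.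
have -> : mkmalgU w (mcoeff w a) = mcoeff w a *: mkmalgU w 1 :> TV K I.
  by rewrite -mul_malgC [RHS]malgM_def fgmulUU mul1m mulr1.
by rewrite [LHS]linearZ_LR [RHS]linearZ_LR; congr (_ *: _); exact: fgw.
Qed.
End FreeAlgebra.

Section Ideals.
Variables (K : pzRingType) (A B : algType K).

Lemma gen_ideal_sub (S : set A) : S `<=` gen_ideal S.
Proof. by move=> a Sa I _; apply. Qed.

Lemma ker_gen_ideal (f : {lrmorphism A -> B}) (S : set A) :
  (forall a, S a -> f a = 0) -> forall a, gen_ideal S a -> f a = 0.
Proof.
move=> fS a /(_ [set a | f a = 0]); apply=> //; split=> [|u v /= fu fv|u v w /= fv].
- exact: rmorph0.
- by rewrite (rmorphD f) -[RHS]addr0; congr (_ + _).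
- transitivity (f u * f v * f w); first by rewrite !rmorphM.
  by rewrite fv mulr0 mul0r.
Qed.

Section Quotient.
Variables (idl : Defs.proper_ideal A) (f : {lrmorphism A -> B}).
Hypothesis f_ker : forall a, ideal_set idl a -> f a = 0.

(** The proof that f vanishes on the ideal is an argument so that the algebra
morphism structures below can be attached to the function. *)
Definition quot_lift_fun & (forall a, ideal_set idl a -> f a = 0) :=
  fun q : quot_alg idl => f (repr q).

Local Notation F := (quot_lift_fun f_ker).

Lemma quot_liftE a : F (proj_alg idl a) = f a.
Proof. by apply/eqP; rewrite -subr_eq0 -rmorphB; apply/eqP/f_ker/repr_proj. Qed.

Lemma quot_lift_is_linear : linear F.
Proof.
move=> c p q; rewrite -(proj_repr p) -(proj_repr q).
by rewrite -linearZ -linearD !quot_liftE linearP.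
Qed.

Lemma quot_lift_is_monoid_morphism : monoid_morphism F.
Proof.
split=> [|p q]; first by rewrite -(rmorph1 (proj_alg idl)) quot_liftE rmorph1.
by rewrite -(proj_repr p) -(proj_repr q) -rmorphM !quot_liftE rmorphM.
Qed.

HB.instance Definition _ :=
  GRing.isLinear.Build K (quot_alg idl) B *:%R F quot_lift_is_linear.
HB.instance Definition _ :=
  GRing.isMonoidMorphism.Build (quot_alg idl) B F quot_lift_is_monoid_morphism.

Definition quot_lift : {lrmorphism quot_alg idl -> B} := F.
End Quotient.
End Ideals.

(** * Transporting the relations *)

Section Relations.
Variables (R : realType) (eta : Cplx R) (n : nat).
Hypotheses (eta_gt0 : 0 < complex.Im eta) (n_gt1 : (1 < n)%N).
Local Notation C := (Cplx R).

Let n_gt0 : (0 < n)%N. Proof. exact: ltnW. Qed.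
Let nC : n%:R != 0 :> C. Proof. by rewrite pnatr_eq0 -lt0n. Qed.

Definition chi (a : 'Z_n) : C := e2pi ((a : nat)%:R / n%:R).

Lemma e2pi_modn (m : nat) : e2pi ((m %% n)%N%:R / n%:R : C) = e2pi (m%:R / n%:R).
Proof.
rewrite -[RHS](e2piDint _ (- (m %/ n)%N%:Z)); congr e2pi.
by rewrite {2}(divn_eq m n) natrD natrM mulrNz; field.
Qed.

Lemma chiD a b : chi (a + b) = chi a * chi b.
Proof.
have vD : nat_of_ord (a + b) = ((a + b)%N %% n)%N.
  by congr modn; exact: Zp_cast.
by rewrite /chi vD e2pi_modn natrD mulrDl e2piD.
Qed.

Lemma chi_neq0 a : chi a != 0.
Proof. exact: e2pi_neq0. Qed.

Lemma thetaZ_opp (a : 'Z_n) z :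
  thetaZ eta a (- z) = - (chi a * e2pi (- (n%:R * z)) * thetaZ eta (- a) z).
Proof.
rewrite /thetaZ theta_alpha_reflection// /chi -e2piD; congr (- (_ * theta_ eta n _ z)).
have an : (a < n)%N by rewrite -[X in (_ < X)%N](Zp_cast n_gt1).
have -> : nat_of_ord (- a) = ((n - a) %% n)%N.
  by congr (modn (subn _ _) _); exact: Zp_cast.
case: eqP => [->|/eqP a0]; first by rewrite subn0 modnn.
by rewrite modn_small; lia.
Qed.

Lemma tens_delta (i j : 'Z_n) : tens (xV R i) (xV R j) = delta_mx i j.
Proof. by rewrite /tens /xV trmx_delta mul_delta_mx. Qed.

Section Twist.
Variables k k' : nat.
Hypothesis kk' : k%:R * k'%:R = 1 :> 'Z_n.
Local Notation K := (k%:R : 'Z_n).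
Local Notation K' := (k'%:R : 'Z_n).

Let KK' : cancel ( *%R K) ( *%R K').
Proof. by move=> a; rewrite mulrA [K' * K]mulrC kk' mul1r. Qed.
Let K'K : cancel ( *%R K') ( *%R K).
Proof. by move=> a; rewrite mulrA kk' mul1r. Qed.

(** The substitution x_i |-> x_(k i) on V (x) V: the matrix entries are read
at the inverse substitution, which is multiplication by k'. *)
Definition twist : VV R n -> VV R n := mxsub ( *%R K') ( *%R K').

HB.instance Definition _ := GRing.Linear.on twist.

Lemma twist_delta i j : twist (delta_mx i j) = delta_mx (K * i) (K * j).
Proof.
by apply/matrixP => a b; rewrite !mxE !(can2_eq K'K KK').
Qed.

Lemma twist_inj : injective twist.
Proof.
move=> u v /matrixP uv; apply/matrixP => a b.
by have := uv (K * a) (K * b); rewrite !mxE !KK'.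
Qed.

(** The heart of the proof. With d = j - i, the reindexing r |-> k (r - d) and
the relation k k' = 1 identify the theta indices on the right with the
opposites of d + (k - 1) r, k r and d - r, the last two exchanged. The
exponential factors of the reflection formula cancel because
d + (k - 1) r = (d - r) + k r. *)
Lemma twist_rij i j tau :
  twist (rij eta k i j tau) = - rij eta k' (K * j) (K * i) tau.
Proof.
rewrite /rij raddf_sum -sumrN.
pose s r := K * (r - (j - i)).
rewrite [RHS](reindex_inj (h := s)); last first.
  by move=> r r' /(can_inj KK')/addIr.
apply: eq_bigr => r _; rewrite [LHS]linearZ_LR /= !tens_delta twist_delta -scaleNr.
congr (_ *: delta_mx _ _); rewrite /s; last first.
- by ring.
- by ring.
have k's : K' * (K * (r - (j - i))) = r - (j - i) by rewrite KK'.
rewrite k's.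
rewrite (_ : K * i - K * j + _ = - (j - i + (K - 1) * r)); last first.
  by rewrite mulrBl k's; ring.
rewrite (_ : K * i - K * j - _ = - (K * r)); last by ring.
rewrite (_ : r - (j - i) = - (j - i - r)); last by ring.
set d := j - i.
have e0 : e2pi (- (n%:R * tau)) * e2pi (- (n%:R * - tau)) = 1 :> C.
  by rewrite mulrN opprK e2piN.
have chi_d : chi (d + (K - 1) * r) = chi (d - r) * chi (K * r).
  by rewrite -chiD; congr chi; ring.
have -> : thetaZ eta (d + (K - 1) * r) 0 =
    - (chi (d - r) * chi (K * r) * thetaZ eta (- (d + (K - 1) * r)) 0).
  by rewrite -{1}[0]oppr0 thetaZ_opp mulr0 oppr0 e2pi0 mulr1 chi_d.
have -> : thetaZ eta (K * r) tau =
    - (chi (K * r) * e2pi (- (n%:R * - tau)) * thetaZ eta (- (K * r)) (- tau)).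
  by rewrite -thetaZ_opp opprK.
rewrite thetaZ_opp; set A := thetaZ _ _ 0; set B := thetaZ _ _ _; set D := thetaZ _ _ _.
have -> : e2pi (- (n%:R * - tau)) = (e2pi (- (n%:R * tau)))^-1.
  by apply: (mulfI (e2pi_neq0 (- (n%:R * tau)))); rewrite e0 mulfV// e2pi_neq0.
move: (chi_neq0 (d - r)) (chi_neq0 (K * r)) (e2pi_neq0 (- (n%:R * tau))).
set x := chi _; set y := chi _; set z := e2pi _ => x0 y0 z0.
(* B and D may vanish, so only the factors x, y and z are simplified. *)
have -> : - (x * z * B) * - (y * z^-1 * D) = x * y * (D * B) by field.
by rewrite mulNr -mulf_div divff ?mul1r// mulf_neq0.
Qed.

Lemma twist_continuous : continuous (twist : VV R n -> VV R n).
Proof.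
move=> M U /nbhs_ballP[e e0 eU]; apply/nbhs_ballP; exists e => //= N [_ MN].
by apply: eU; split=> // a b; rewrite !mxE; exact: MN.
Qed.

Lemma derivable_twist (f : C -> VV R n) (z : C) :
  derivable (f : C^o -> VV R n) z 1 ->
  derivable (fun w : C^o => twist (f w) : VV R n) z 1.
Proof.
move=> /cvg_ex[l fl]; apply/cvg_ex; exists (twist l).
have /(_ (dnbhs_filter _)) := continuous_cvg _ (@twist_continuous l) fl.
set u := twist \o _; set v := (X in _ -> X @ _ --> _).
have -> // : u = v.
by apply/funext => h; rewrite /u /v /= -[LHS]/(twist _) [LHS]linearZ_LR /= linearB.
Qed.

Definition twistV : 'End(VV R n) := linfun twist.

Lemma extends_rij_twist i j L : extends_rij eta k i j L ->
  extends_rij eta k' (K * j) (K * i) (fun z => twistV @: L z)%VS.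
Proof.
move=> [[Lper Lloc] Lrij]; split; [split|].
- by move=> z l /(Lper z) ->.
- move=> z0; have [f Pf] := Lloc z0; exists (fun z => twist (f z)).
  apply: filterS Pf => z [fz0 Lz dfz]; split.
  + by rewrite -(inj_eq twist_inj) linear0 in fz0.
  + by rewrite Lz limg_line lfunE.
  + exact: derivable_twist.
- move=> tau /Lrij ->; rewrite limg_line lfunE /= twist_rij.
  apply/eqP; rewrite eqEsubv; apply/andP; split; apply/vlineP; exists (-1).
  + by rewrite scaleN1r.
  + by rewrite scaleN1r opprK.
Qed.

End Twist.

(** A torsion point has only non-torsion points at real distance less than
1 / n from it: two torsion points which differ by a real number differ by a
multiple of 1 / n, because eta is not real. *)
Lemma torsion_dense (z0 : C) (U : set C) : nbhs z0 U ->
  exists2 z, U z & ~ torsion eta n z.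
Proof.
move=> Uz0; case: (pselect (torsion eta n z0)); last first.
  by move=> tz0; exists z0 => //; exact: nbhs_singleton.
move=> [_ [a [b ->]] z0E].
move: Uz0 => /nbhs_ballP[e /= e0 eU].
have ee : e = ((complex.Re e)%:C)%C by rewrite RRe_real// gtr0_real.
have e0' : 0 < complex.Re e by move: e0; rewrite ee ltcR.
have nR : 0 < n%:R :> R by rewrite ltr0n.
pose s := Num.min (complex.Re e) n%:R^-1 / 2.
have m0 : 0 < Num.min (complex.Re e) n%:R^-1 by rewrite lt_min e0' invr_gt0.
have s0 : 0 < s by rewrite divr_gt0.
have sm : s < Num.min (complex.Re e) n%:R^-1 by rewrite /s; lra.
move: sm; rewrite lt_min => /andP[se sn].
exists (z0 + (s%:C)%C).
  apply: eU; rewrite /ball /= opprD addrA subrr sub0r normrN.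
  by rewrite normc_def /= expr0n addr0 sqrtr_sqr ee ltcR ger0_norm// ltW.
move=> [_ [c [d ->]]]; rewrite z0E => E.
(* E equates a lattice vector with the real number n s, which lies in ]0, 1[. *)
have {}E : (c - a)%:~R + (d - b)%:~R * eta = ((n%:R * s)%:C)%C :> C.
  rewrite (rmorphM (@real_complex R)) rmorph_nat; move: E; rewrite !intrB.
  move/(congr1 (fun z => n%:R * z)) => E.
  have -> : n%:R * (s%:C)%C = n%:R * ((a%:~R + b%:~R * eta) / n%:R + (s%:C)%C)
      - (a%:~R + b%:~R * eta) :> C by field.
  by rewrite E; field.
have realE (p : int) : p%:~R = ((p%:~R)%:C)%C :> C.
  by rewrite (rmorph_int (@real_complex R)).
have ns : n%:R * s < 1 by rewrite -ltr_pdivlMl// mulr1.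
have ns0 : 0 < n%:R * s by rewrite mulr_gt0.
move: E; set p := c - a; set q := d - b; rewrite !realE => E.
have /eqP : ((p%:~R + q%:~R * complex.Re eta) +i* (q%:~R * complex.Im eta))%C =
    ((n%:R * s)%:C)%C.
  by rewrite -E; case: (eta) => x y; apply/eqP; rewrite eq_complex /=
     mul0r subr0 mul0r addr0 add0r !eqxx.
rewrite eq_complex /= => /andP[/eqP Re0 /eqP Im0].
have q0 : q%:~R = 0 :> R.
  by move/eqP: Im0; rewrite mulf_eq0 (gt_eqF eta_gt0) orbF => /eqP.
move: Re0; rewrite q0 mul0r addr0 => Re0.
move: ns ns0; rewrite -Re0 ltr0z -[1]/(1%:~R) ltr_int; lia.
Qed.

Lemma vline_minors p q (u v : 'M[C]_(p, q)) : u != 0 -> v != 0 ->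
  (forall a b c d, u a b * v c d = u c d * v a b) -> (<[u]> = <[v]>)%VS.
Proof.
move=> u0 v0 uv; have /existsP[a /existsP[b uab]] : [exists a, exists b, u a b != 0].
  apply: contraNT u0 => /existsPn u0; apply/eqP/matrixP => a b; rewrite mxE.
  by have /existsPn/(_ b) := u0 a; rewrite negbK => /eqP.
have vE : v = (v a b / u a b) *: u.
  by apply/matrixP => c d; rewrite mxE mulrAC; apply/(canRL (mulfK uab)); rewrite mulrC uv mulrC.
apply/esym/eqP; rewrite eqEdim !dim_vline u0 v0 leqnn andbT.
by apply/vlineP; exists (v a b / u a b).
Qed.

(** Two extensions have proportional lifts on the dense complement of the
torsion, hence everywhere by continuity of the 2 x 2 minors of the lifts. *)
Lemma morphism_unique (L L' : C -> {vspace VV R n}) :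
  is_morphism eta L -> is_morphism eta L' ->
  (forall tau, ~ torsion eta n tau -> L tau = L' tau) -> forall z0, L z0 = L' z0.
Proof.
move=> [_ locL] [_ locL'] LL' z0.
have [f Pf] := locL z0; have [g Pg] := locL' z0.
have [f0 -> df] := nbhs_singleton Pf; have [g0 -> dg] := nbhs_singleton Pg.
have cont (h : C -> VV R n) a b : derivable (h : C^o -> VV R n) z0 1 ->
    (h z a b : C) @[z --> z0] --> (h z0 a b : C).
  move=> /derivable1_diffP/differentiable_continuous ch.
  exact: (continuous_cvg _ (@coord_continuous _ _ _ a b _) ch).
apply: vline_minors => // a b c d; apply/eqP; rewrite -subr_eq0; apply/negPn/negP => m0.
pose m z : C := f z a b * g z c d - f z c d * g z a b.
have cm : m z @[z --> z0] --> m z0.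
  apply: (@cvgB C C^o _ (nbhs z0) _); apply: (@cvgM C _ (nbhs z0) _); exact: cont.
have /torsion_dense[z [[[fz0 Lz _] [gz0 L'z _]] mz] /LL'] : nbhs z0
    ([set z | [/\ f z != 0, L z = <[f z]>%VS & derivable (f : C^o -> VV R n) z 1]]
     `&` [set z | [/\ g z != 0, L' z = <[g z]>%VS & derivable (g : C^o -> VV R n) z 1]]
     `&` [set z | m z != 0]).
  have m_neq0 : nbhs z0 [set z | m z != 0].
    exact: (@cvgr_neq0 C C^o _ (nbhs z0) _ m (m z0) cm m0).
  exact: filterI (filterI Pf Pg) m_neq0.
rewrite Lz L'z => fg; have /vlineP[x fE] : f z \in <[g z]>%VS by rewrite -fg memv_line.
by move: mz; rewrite /= /m fE !mxE mulrAC subrr eqxx.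
Qed.

Section TwistRelations.
Variables k k' : nat.
Hypothesis kk' : k%:R * k'%:R = 1 :> 'Z_n.
Local Notation K := (k%:R : 'Z_n).

(** If r_ij has an extension, its image extends r_(k j, k i), and uniqueness
identifies it with the chosen one; otherwise L_ij is 0 by default. *)
Lemma twist_Lij i j tau :
  (twistV k' @: Lij eta k i j tau <= Lij eta k' (K * j) (K * i) tau)%VS.
Proof.
rewrite {1}/Lij; case: xgetP => [L _ PL|_]; last by rewrite limg0 sub0v.
have PL' := extends_rij_twist kk' PL; rewrite /Lij.
case: xgetP => [L' _ [mL' rL']|/(_ _ PL')//].
case: PL' => mL rL; rewrite (morphism_unique mL mL')// => z tz.
by rewrite rL// rL'.
Qed.

Lemma twist_rel tau w :
  w \in rel_nk eta n k tau -> twist k' w \in rel_nk eta n k' tau.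
Proof.
suff /subvP sub : (twistV k' @: rel_nk eta n k tau <= rel_nk eta n k' tau)%VS.
  by move=> /(memv_img (twistV k'))/sub; rewrite lfunE.
rewrite /rel_nk limg_sum; apply/subv_sumP => -[i j] /= /asboolP[t tt rt].
apply: subv_trans (twist_Lij i j tau) _.
apply: (sumv_sup (K * j, K * i)); last exact: subvv.
apply/asboolP; exists t; first exact: tt.
rewrite /fst /snd -oppr_eq0 -(twist_rij kk') -(linear0 (twist k')).
by rewrite (inj_eq (twist_inj kk')).
Qed.
End TwistRelations.
End Relations.

(** * The isomorphism *)

Lemma deg2_morph (R : realType) (n : nat) (A : algType (Cplx R))
    (h : {lrmorphism TV (Cplx R) 'Z_n -> A}) (y : 'Z_n -> A) (w : VV R n) :
  (forall i, h (xT (Cplx R) i) = y i) ->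
  h (deg2 w) = \sum_i \sum_j w i j *: (y i * y j).
Proof.
move=> hE; rewrite /deg2 raddf_sum; apply: eq_bigr => i _.
rewrite raddf_sum; apply: eq_bigr => j _.
transitivity (w i j *: h (xT (Cplx R) i * xT (Cplx R) j)).
  exact: linearZ_LR.
congr (_ *: _); rewrite -!hE; exact: rmorphM.
Qed.

Section Isomorphism.
Variables (R : realType) (eta : Cplx R) (n : nat) (tau : Cplx R).
Hypotheses (eta_gt0 : 0 < complex.Im eta) (n_gt1 : (1 < n)%N).
Local Notation C := (Cplx R).

Definition rescale (k k' : nat) : {lrmorphism TV C 'Z_n -> Q eta n k' tau} :=
  TV_lift (fun i => xQ eta k' tau (k%:R * i)).

Lemma rescale_rel (k k' : nat) (kk' : k%:R * k'%:R = 1 :> 'Z_n) a :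
  rel_ideal eta k tau a -> rescale k k' a = 0.
Proof.
move: a; apply: ker_gen_ideal => _ [w /= w_rel <-].
pose pr : {lrmorphism TV C 'Z_n -> Q eta n k' tau} := proj_alg (Q_ideal eta n k' tau).
have KK' (i : 'Z_n) : k'%:R * (k%:R * i) = i.
  by rewrite mulrA [_ * k%:R]mulrC kk' mul1r.
have -> : rescale k k' (deg2 w) = pr (deg2 (twist k' w)).
  rewrite (deg2_morph _ (TV_liftE _))
    (deg2_morph (h := pr) (y := xQ eta k' tau) _ (fun=> erefl)).
  rewrite [RHS](reindex_inj (can_inj KK')); apply: eq_bigr => i _.
  rewrite [RHS](reindex_inj (can_inj KK')); apply: eq_bigr => j _.
  by rewrite [twist _ _ _ _]mxE !KK'.
have rel : rel_ideal eta k' tau (deg2 (twist k' w)).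
  apply: (gen_ideal_sub (S := (@deg2 R n @` [set` rel_nk eta n k' tau]))).
  exists (twist k' w); last by [].
  exact: (twist_rel eta_gt0 n_gt1 kk' w_rel).
transitivity (pr 0); last exact: rmorph0.
by apply/proj_eq; rewrite subr0.
Qed.

Definition Q_morph (k k' : nat) (kk' : k%:R * k'%:R = 1 :> 'Z_n) :
    {lrmorphism Q eta n k tau -> Q eta n k' tau} :=
  quot_lift (idl := Q_ideal eta n k tau) (rescale_rel kk').

Lemma Q_morph_xQ (k k' : nat) (kk' : k%:R * k'%:R = 1 :> 'Z_n) i :
  Q_morph kk' (xQ eta k tau i) = xQ eta k' tau (k%:R * i).
Proof.
transitivity (rescale k k' (xT C i)); last exact: TV_liftE.
exact: (quot_liftE (idl := Q_ideal eta n k tau) (rescale_rel kk')).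
Qed.

Lemma Q_morphK (k k' : nat) (kk' : k%:R * k'%:R = 1 :> 'Z_n)
    (k'k : k'%:R * k%:R = 1 :> 'Z_n) :
  cancel (Q_morph kk') (Q_morph k'k).
Proof.
pose pr : {lrmorphism TV C 'Z_n -> Q eta n k tau} := proj_alg (Q_ideal eta n k tau).
have pr_ext : (Q_morph k'k \o Q_morph kk' \o pr : {lrmorphism _ -> _}) =1 pr.
  apply: TV_ext => i.
  transitivity (Q_morph k'k (Q_morph kk' (xQ eta k tau i))); first by [].
  by rewrite !Q_morph_xQ mulrA k'k mul1r.
by move=> q; rewrite -(proj_repr q); exact: pr_ext.
Qed.
End Isomorphism.

Theorem proposition3p21 (R : realType) (eta : Cplx R)
    (eta_gt0 : 0 < complex.Im eta)
    (n k k' : nat) (k_bounds : (1 <= k < n)%N) (k_coprime : coprime n k)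
    (k'_bounds : (1 <= k' < n)%N) (kk' : k%:R * k'%:R = 1 :> 'Z_n)
    (tau : Cplx R) :
  exists Phi : {lrmorphism Q eta n k tau -> Q eta n k' tau},
    bijective Phi /\
    forall i : 'Z_n, Phi (xQ eta k tau i) = xQ eta k' tau (k%:R * i).
Proof.
have n_gt1 : (1 < n)%N by case/andP: k_bounds; exact: leq_ltn_trans.
have k'k : k'%:R * k%:R = 1 :> 'Z_n by rewrite mulrC.
exists (Q_morph tau eta_gt0 n_gt1 kk'); split; last exact: Q_morph_xQ.
by exists (Q_morph tau eta_gt0 n_gt1 k'k); exact: Q_morphK.
Qed.
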